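(* Let $F:\mathbb{R}^n\to\mathbb{R}^n$, $x_k\in\mathbb{R}^n$, $F_k=F(x_k)$, $\beta_k\in\mathbb{R}$, and let $p_k=-\beta_kF_k\neq0$, $x_{k+1}=x_k+p_k$, $F_{k+1}=F(x_{k+1})$. Suppose that $F$ is continuously differentiable in an open convex set $D\subset\mathbb{R}^n$ containing $x_k+t\,p_k$ for all $t\in[0,1]$, and that the Jacobian $J$ of $F$ is symmetric. Let $G_k=\int_0^1J(x_k+t\,p_k)\,dt$, let $\{\lambda_i(G_k)\}_{i=1}^n$ be the eigenvalues of $G_k$ and $\{v_i\}_{i=1}^n$ a set of associated orthonormal eigenvectors. Write $$F_k=\sum_{i=1}^n\mu_k^i v_i,\qquad F_{k+1}=\sum_{i=1}^n\mu_{k+1}^i v_i,$$ with scalars $\mu_k^i,\mu_{k+1}^i$, $i=1,\dots,n$. Then $$F_{k+1}=(I-\beta_kG_k)F_k,$$ $$\mu_{k+1}^i=\mu_k^i\big(1-\beta_k\lambda_i(G_k)\big),\qquad i=1,\dots,n.$$ Moreover, it holds: (a) if $\beta_k\lambda_i(G_k)=1$, then $|\mu_{k+1}^i|=0$; (b) if $0<\beta_k\lambda_i(G_k)<2$, then $|\mu_{k+1}^i|<|\mu_k^i|$; otherwise $|\mu_{k+1}^i|\ge|\mu_k^i|$.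
   Context: $I$ denotes the $n\times n$ identity matrix, and $J(x)$ denotes the Jacobian matrix of $F$ at $x$.
   Formalization: In (b), the strict inequality |μ_{k+1}^i| < |μ_k^i| is stated only when μ_k^i ≠ 0, since for μ_k^i = 0 both sides are 0 and the inequality fails. *)

(* Defs.v *)
(* MathComp-Analysis; vectors of R^n are columns. *)
From HB Require Import structures.
From mathcomp Require Import all_boot all_order all_algebra.
From mathcomp Require Import all_classical all_reals all_analysis.

Set Implicit Arguments.
Unset Strict Implicit.
Unset Printing Implicit Defensive.

Import Order.TTheory GRing.Theory Num.Theory.
Import numFieldNormedType.Exports.

Local Open Scope classical_set_scope.
Local Open Scope ring_scope.

(* The library's ['J] is for maps between row vectors and acts on the right
   ('D_v f x = v *m 'J f x); the transpositions turn it into the usual matrix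
   with entries d F_i / d x_j, acting on columns. *)
Definition jacobian_mx (R : realType) (n : nat) (F : 'cV[R]_n -> 'cV[R]_n)
    (x : 'cV[R]_n) : 'M[R]_n :=
  ('J (fun y : 'rV[R]_n => (F y^T)^T) (x^T))^T.

Definition continuously_differentiable_on (R : realType) (n : nat)
    (D : set 'cV[R]_n) (F : 'cV[R]_n -> 'cV[R]_n) : Prop :=
  (forall x, D x -> differentiable F x) /\
  {within D, continuous (jacobian_mx F)}.

(* The matrix-valued integral is taken entrywise. *)
Definition mean_jacobian (R : realType) (n : nat) (F : 'cV[R]_n -> 'cV[R]_n)
    (x p : 'cV[R]_n) : 'M[R]_n :=
  \matrix_(i, j)
    \int[@lebesgue_measure R]_(t in `[0, 1]) jacobian_mx F (x + t *: p) i j.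

Definition orthonormal_family (R : realType) (n : nat)
    (v : 'I_n -> 'cV[R]_n) : Prop :=
  forall i j, (v i)^T *m v j = ((i == j)%:R)%:M.

(* Main.v *)
Require Import Defs.
From HB Require Import structures.
From mathcomp Require Import all_boot all_order all_algebra.
From mathcomp Require Import all_classical all_reals all_analysis.
From mathcomp Require Import lra.

Set Implicit Arguments.
Unset Strict Implicit.
Unset Printing Implicit Defensive.

Import Order.TTheory GRing.Theory Num.Theory.
Import numFieldNormedType.Exports.

Local Open Scope classical_set_scope.
Local Open Scope ring_scope.

(** With p = - beta F(x_k), the fundamental theorem of calculus along the
    segment from x_k to x_k + p gives F(x_k + p) - F(x_k) = G p, where G
    averages the Jacobian over the segment
    ([increment_mean_jacobian]).  Substituting p turns this into
    F(x_{k+1}) = (I - beta G) F(x_k).  In an orthonormal eigenbasis of G the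
    matrix I - beta G is diagonal with entries 1 - beta lambda_i, and
    coordinates in an orthonormal family are unique
    ([orthonormal_family_coef_inj]); hence mu_{k+1}^i = mu_k^i (1 - beta
    lambda_i).  The claims (a) and (b) follow from the fact that
    |1 - y| < 1 exactly when 0 < y < 2. *)

Lemma trmx_continuous (R : realType) (m n : nat) :
  continuous (@trmx R m n).
Proof.
move=> M s /= /(nbhs_ballP M^T) [e e0 es].
apply/nbhs_ballP; exists e => //= N [e0' MN]; apply: es.
by split=> // i j; rewrite !mxE; exact: MN.
Qed.

(** Transposition is linear and continuous, hence its own differential, so the
    chain rule undoes the conjugation by transpositions through which
    [jacobian_mx] is obtained from the Jacobian of maps between rows. *)
Lemma derive_jacobian_mx (R : realType) (n : nat) (F : 'cV[R]_n -> 'cV[R]_n)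
    (x p : 'cV[R]_n) :
  differentiable F x -> 'D_p F x = jacobian_mx F x *m p.
Proof.
move=> dF.
have dtr m k (M : 'M[R]_(m, k)) : differentiable (@trmx R m k) M.
  exact/linear_differentiable/trmx_continuous.
have trE m k (M : 'M[R]_(m, k)) : 'd (@trmx R m k) M = @trmx R m k :> (_ -> _).
  by apply: diff_lin; exact: trmx_continuous.
have dFt : differentiable (F \o @trmx R 1 n) x^T.
  by apply: differentiable_comp; rewrite ?trmxK.
have FtE : 'd (F \o @trmx R 1 n) (x^T) = 'd F x \o @trmx R 1 n :> (_ -> _).
  by rewrite (@diff_comp _ _ _ _ (@trmx R 1 n) F) ?trE ?trmxK.
have dtFt : differentiable (@trmx R n 1 \o (F \o @trmx R 1 n)) x^T.
  exact: (@differentiable_comp _ _ _ _ (F \o @trmx R 1 n) (@trmx R n 1)).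
rewrite /jacobian_mx -[in RHS](trmxK p) -trmx_mul -deriveEjacobian //.
rewrite !deriveE //.
rewrite (@diff_comp _ _ _ _ (F \o @trmx R 1 n) (@trmx R n 1)) // trE FtE.
by rewrite /= !trmxK.
Qed.

(** The increment h in the parameter s moves the point of the line by h p, so
    the two difference quotients are the same function of h. *)
Lemma derivable_line (R : realType) (V W : normedModType R) (F : V -> W)
    (x p : V) (t : R) :
  derivable F (x + t *: p) p -> derivable (fun s : R => F (x + s *: p)) t 1.
Proof.
rewrite /derivable; set g1 := fun h => h^-1 *: _; set g2 := fun h => h^-1 *: _.
suff -> : g1 = g2 by [].
apply/funext => h; rewrite /g1 /g2 /=.
by rewrite [h%:A]mulr1 /= scalerDl addrCA.
Qed.

Lemma derive_line (R : realType) (V W : normedModType R) (F : V -> W)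
    (x p : V) (t : R) :
  'D_1 (fun s : R => F (x + s *: p)) t = 'D_p F (x + t *: p).
Proof.
rewrite /derive; set g1 := fun h => h^-1 *: _; set g2 := fun h => h^-1 *: _.
suff -> : g1 = g2 by [].
apply/funext => h; rewrite /g1 /g2 /=.
by rewrite [h%:A]mulr1 /= scalerDl addrCA.
Qed.

Lemma line_continuous (R : realType) (V : normedModType R) (x p : V) :
  continuous (fun t : R => x + t *: p).
Proof. by move=> t; apply: cvgD; [exact: cvg_cst|exact: scalel_continuous]. Qed.

(** Each coordinate t |-> F_i(x + t p) has the continuous derivative
    (J(x + t p) p)_i on [0, 1], so the fundamental theorem of calculus applies
    coordinatewise; p does not depend on t, so it leaves the integral. *)
Lemma increment_mean_jacobian (R : realType) (n : nat)
    (F : 'cV[R]_n -> 'cV[R]_n) (D : set 'cV[R]_n) (x p : 'cV[R]_n) :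
  open D -> (forall t : R, 0 <= t <= 1 -> D (x + t *: p)) ->
  continuously_differentiable_on D F ->
  F (x + p) - F x = mean_jacobian F x p *m p.
Proof.
move=> oD segD [dF]; rewrite continuous_open_subspace // => cJ.
have dline (t : R) : 0 <= t <= 1 ->
    derivable (fun s : R => F (x + s *: p)) t 1.
  by move=> /segD/dF ?; apply/derivable_line/diff_derivable.
have cline i j : {within `[0, 1],
    continuous (fun t : R => jacobian_mx F (x + t *: p) i j : R^o)}.
  apply: continuous_in_subspaceT => t; rewrite inE /= in_itv /= => /segD Dt.
  apply: (@continuous_comp _ _ _ (fun t : R => jacobian_mx F (x + t *: p))
    (fun M : 'M[R]_n => M i j)); last exact: coord_continuous.
  apply: continuous_comp; first exact: line_continuous.
  by apply: cJ; rewrite inE.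
have cterm i k : {within `[0, 1], continuous
    (fun t : R => jacobian_mx F (x + t *: p) i k * p k 0 : R^o)}.
  by move=> t; apply: cvgM; [exact: cline|exact: cvg_cst].
have integrable01 (g : R -> R^o) : {within `[0, 1], continuous g} ->
    (@lebesgue_measure R).-integrable `[0, 1] (EFin \o g).
  by move=> cg; apply: continuous_compact_integrable => //;
    exact: segment_compact.
have dcoord (t : R) i : 0 <= t <= 1 ->
    derivable (fun s : R => F (x + s *: p) i 0) t 1.
  by move=> /dline/derivable_mxP.
have ccoord (t : R) i : 0 <= t <= 1 ->
    {for t, continuous (fun s : R => F (x + s *: p) i 0 : R^o)}.
  by move=> /(dcoord _ i)/derivable1_diffP/differentiable_continuous.
apply/matrixP => i j; rewrite [j]ord1 !mxE.
pose f (t : R) := \sum_k jacobian_mx F (x + t *: p) i k * p k 0.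
have cf : {within `[0, 1], continuous (f : R -> R^o)}.
  move=> t; rewrite /f.
  by apply: (@cvg_big _ _ +%R) => [|k _]; [exact: add_continuous|exact: cterm].
have dF_oo : derivable_oo_LRcontinuous (fun s : R => F (x + s *: p) i 0) 0 1.
  split=> [t|/=|/=].
  - by rewrite in_itv /= => /andP[/ltW t0 /ltW t1]; apply: dcoord; rewrite t0.
  - by apply: cvg_at_right_filter; apply: ccoord; rewrite lexx ler01.
  - by apply: cvg_at_left_filter; apply: ccoord; rewrite lexx ler01.
have dFE : {in `]0, 1[,
    ((fun s : R => F (x + s *: p) i 0)^`())%classic =1 f}.
  move=> t; rewrite in_itv /= => /andP[/ltW t0 /ltW t1].
  have t01 : 0 <= t <= 1 by rewrite t0.
  have := derive_mx (dline _ t01).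
  rewrite derive_line derive_jacobian_mx; last exact/dF/segD.
  by move=> /matrixP/(_ i 0); rewrite !mxE derive1E => <-.
have := continuous_FTC2 ltr01 cf dF_oo dFE.
rewrite scale1r scale0r addr0 /f.
under eq_integral do rewrite -sumEFin.
rewrite integral_sum //=; last by move=> k; exact: (integrable01 _ (cterm i k)).
have termE k : (\int[@lebesgue_measure R]_(t in `[0%R, 1%R])
      (jacobian_mx F (x + t *: p) i k * p k 0)%:E)%E =
    (mean_jacobian F x p i k * p k 0)%:E.
  rewrite mxE -RintegralZr //; last exact: (integrable01 _ (cline i k)).
  rewrite /Rintegral fineK //; apply: integrable_fin_num => //.
  exact: (integrable01 _ (cterm i k)).
by under eq_bigr do rewrite termE; rewrite sumEFin -EFinB => -[<-].
Qed.

Lemma orthonormal_family_coef_inj (R : realType) (n : nat)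
    (v : 'I_n -> 'cV[R]_n) (a b : 'I_n -> R) :
  orthonormal_family v ->
  \sum_(i < n) a i *: v i = \sum_(i < n) b i *: v i -> a =1 b.
Proof.
move=> hv ab i.
have coefE (c : 'I_n -> R) : (v i)^T *m (\sum_j c j *: v j) = (c i)%:M.
  rewrite mulmx_sumr (bigD1 i) //= big1 => [|j ji]; last first.
    by rewrite -scalemxAr hv eq_sym (negPf ji) raddf0 scaler0.
  by rewrite addr0 -scalemxAr hv eqxx scale_scalar_mx mulr1.
by have /matrixP/(_ 0 0) := coefE a; rewrite ab coefE !mxE eqxx !mulr1n => ->.
Qed.

Lemma normr_1B_lt1 (R : realType) (y : R) : (`|1 - y| < 1) = (0 < y < 2).
Proof.
by rewrite ltr_norml; apply/andP/andP => -[h1 h2]; split; lra.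
Qed.

Theorem lemma4p1 (R : realType) (n : nat) (F : 'cV[R]_n -> 'cV[R]_n)
    (xk pk xk1 : 'cV[R]_n) (betak : R) (D : set 'cV[R]_n)
    (hpk : pk = - betak *: F xk) (hpk0 : pk != 0)
    (hxk1 : xk1 = xk + pk)
    (hDopen : open D) (hDconvex : convex_set D)
    (hDseg : forall t : R, 0 <= t <= 1 -> D (xk + t *: pk))
    (hFC1 : continuously_differentiable_on D F)
    (hJsym : forall x, D x -> jacobian_mx F x \is symmetricmx)
    (Gk : 'M[R]_n) (hGk : Gk = mean_jacobian F xk pk)
    (lambda : 'I_n -> R) (v : 'I_n -> 'cV[R]_n)
    (hv : orthonormal_family v)
    (heig : forall i, Gk *m v i = lambda i *: v i)
    (muk muk1 : 'I_n -> R)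
    (hmuk : F xk = \sum_(i < n) muk i *: v i)
    (hmuk1 : F xk1 = \sum_(i < n) muk1 i *: v i) :
  [/\ F xk1 = (1%:M - betak *: Gk) *m F xk,
      forall i, muk1 i = muk i * (1 - betak * lambda i),
      forall i, betak * lambda i = 1 -> `|muk1 i| = 0 &
      forall i,
        (0 < betak * lambda i < 2 -> muk i != 0 -> `|muk1 i| < `|muk i|) /\
        (~~ (0 < betak * lambda i < 2) -> `|muk1 i| >= `|muk i|)].
Proof.
have step : F xk1 = (1%:M - betak *: Gk) *m F xk.
  have := increment_mean_jacobian hDopen hDseg hFC1.
  rewrite -hxk1 -hGk hpk scaleNr mulmxN -scalemxAr => incr.
  by rewrite mulmxBl mul1mx -scalemxAl -incr addrC subrK.
have coef i : muk1 i = muk i * (1 - betak * lambda i).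
  move: i; apply: (orthonormal_family_coef_inj hv).
  rewrite -hmuk1 step hmuk mulmx_sumr; apply: eq_bigr => i _.
  rewrite -scalemxAr mulmxBl mul1mx -scalemxAl heig scalerA.
  by rewrite -{1}[v i]scale1r -scalerBl scalerA.
split=> // [i bl1|i]; first by rewrite coef bl1 subrr mulr0 normr0.
rewrite coef normrM -normr_1B_lt1; split=> [contr mu0|].
  by rewrite gtr_pMr // normr_gt0.
by rewrite -leNgt => expand; rewrite ler_peMr.
Qed.
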